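(* For every integer $n\geq 2$, $$\frac{2^{n^2-n-1}}{n!\,(2^n-n)}\leq B_n<\frac{4}{n!}\,2^{n^2-n}.$$ For $n=1$, one has $B_1=1$.
   Context: For a positive integer $n$, a collection $\Phi\subseteq 2^{[n]}$ is balanced if there exist positive real weights $(\lambda_S)_{S\in\Phi}$ such that $\sum_{S\in\Phi}\lambda_S\mathbf{1}_S=\mathbf{1}$, where $\mathbf{1}_S\in\{0,1\}^n$ is the characteristic vector of $S$ and $\mathbf{1}=(1,\dots,1)^{\mathsf T}\in\mathbb{R}^n$. A balanced collection is minimal if none of its proper subcollections is balanced. $B_n$ denotes the number of minimal balanced collections on $[n]$. *)

(* Defs.v *)
From mathcomp Require Import all_boot all_order all_algebra.
From mathcomp Require Import boolp reals.

Set Implicit Arguments.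
Unset Strict Implicit.
Unset Printing Implicit Defensive.

Import Order.TTheory GRing.Theory Num.Theory.
Local Open Scope ring_scope.

(* The ground set [n] = {1, ..., n} is encoded as 'I_n = {0, ..., n-1}. *)

Definition char_vec (R : realType) (n : nat) (S : {set 'I_n}) : 'cV[R]_n :=
  \col_i (i \in S)%:R.

(* The weights are given by a total function on subsets; only its values on
   the members of Phi matter. Phi may contain the empty set. *)
Definition balanced (R : realType) (n : nat) (Phi : {set {set 'I_n}}) : Prop :=
  exists lambda : {set 'I_n} -> R,
    (forall S, S \in Phi -> 0 < lambda S) /\
    \sum_(S in Phi) lambda S *: char_vec R S = const_mx 1.

Definition minimal_balanced (R : realType) (n : nat)
    (Phi : {set {set 'I_n}}) : Prop :=
  balanced R Phi /\
  forall Psi : {set {set 'I_n}}, Psi \proper Phi -> ~ balanced R Psi.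

(* B_n, where R is the field of real numbers carrying the weights. *)
Definition num_minimal_balanced (R : realType) (n : nat) : nat :=
  #|[set Phi : {set {set 'I_n}} | `[< minimal_balanced R Phi >]]|.

(* Main.v *)
Require Import Defs.
From mathcomp Require Import all_boot all_order all_algebra.
From mathcomp Require Import boolp reals zify.

Set Implicit Arguments.
Unset Strict Implicit.
Unset Printing Implicit Defensive.

Import Order.TTheory GRing.Theory Num.Theory.
Local Open Scope ring_scope.

(* Replacing a set by its complement negates its characteristic vector modulo
   the all-one vector.  A minimal balanced collection carries, modulo that
   vector, a unique relation up to a scalar; so among all the collections that
   arise from it by complementing members, only the collection itself and its
   memberwise complement can be minimal balanced.

   Upper bound: choosing from each complementary pair the set that avoids the
   element 0 maps the minimal balanced collections at most two-to-one into the
   nonempty families of at most n of the 2^(n-1) sets avoiding 0.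

   Lower bound: for A invertible over F_2 of size n-1, the n rows obtained by
   adding to A the sum of its rows, read as real 0/1 vectors, have all their
   maximal minors odd, hence a unique relation, with nonzero coefficients only.
   Complementing according to the signs of the coefficients gives two ordered
   minimal balanced collections, and |GL_(n-1)(F_2)| >= 2^((n-1)^2) / 4. *)

(** * Relations among the members of a minimal balanced collection *)

Lemma balancedE (R : realType) n (Phi : {set {set 'I_n}}) :
  balanced R Phi <->
  exists2 lambda : {set 'I_n} -> R, forall S, S \in Phi -> 0 < lambda S &
    forall i, \sum_(S in Phi) lambda S * (i \in S)%:R = 1.
Proof.
split=> [[l [l_gt0 sum_l]]|[l l_gt0 sum_l]]; exists l => //.
  move=> i; have /matrixP/(_ i ord0) := sum_l; rewrite summxE mxE => sum_l_i.
  by rewrite -[RHS]sum_l_i; apply: eq_bigr => S _; rewrite !mxE.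
split=> //; apply/colP=> i; rewrite summxE mxE -[RHS](sum_l i).
by apply: eq_bigr => S _; rewrite !mxE.
Qed.

Lemma not_balanced0 (R : realType) n : ~ balanced R (set0 : {set {set 'I_n.+1}}).
Proof.
move=> /balancedE [l _ /(_ ord0)]; rewrite big_set0 => /esym/eqP.
by rewrite oner_eq0.
Qed.

Lemma minimal_balanced_sub_eq (R : realType) n (Phi Psi : {set {set 'I_n}}) :
  minimal_balanced R Phi -> balanced R Psi -> Psi \subset Phi -> Psi = Phi.
Proof.
move=> [_ min_Phi] balPsi sub; apply/eqP; apply: contraT => neq.
by case: (min_Phi Psi) => //; rewrite properEneq neq.
Qed.

(* Moving from the weights along a relation with a positive coefficient until
   the first weight vanishes yields a smaller balanced subcollection. *)
Lemma minimal_balanced_le0 (R : realType) n (Phi : {set {set 'I_n}})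
    (g : {set 'I_n} -> R) :
  minimal_balanced R Phi ->
  (forall i, \sum_(S in Phi) g S * (i \in S)%:R = 0) ->
  forall S, S \in Phi -> g S <= 0.
Proof.
move=> minPhi sum_g S0 S0Phi; rewrite leNgt; apply/negP => gS0_gt0.
have [/balancedE [l l_gt0 sum_l] _] := minPhi.
have P0 : (S0 \in Phi) && (0 < g S0) by rewrite S0Phi.
have [S1 /andP[S1Phi gS1_gt0] S1_min] :=
  arg_minP (P := fun S => (S \in Phi) && (0 < g S)) (fun S => l S / g S) P0.
pose l' S := l S - l S1 / g S1 * g S.
have l'_ge0 S : S \in Phi -> 0 <= l' S.
  move=> SPhi; rewrite subr_ge0; have [gS_gt0|gS_le0] := ltP 0 (g S).
    by rewrite -ler_pdivlMr // S1_min // SPhi.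
  apply: le_trans (ltW (l_gt0 _ SPhi)).
  by rewrite mulr_ge0_le0 // divr_ge0 // ltW // l_gt0.
have l'S1 : l' S1 = 0 by rewrite /l' divfK ?subrr // gt_eqF.
have bal' : balanced R [set S in Phi | 0 < l' S].
  apply/balancedE; exists l' => [S|i]; first by rewrite inE => /andP[].
  rewrite (eq_bigl (fun S => (S \in Phi) && (0 < l' S))); last first.
    by move=> S; rewrite inE.
  transitivity (\sum_(S in Phi) l' S * (i \in S)%:R).
    rewrite [RHS](bigID (fun S => 0 < l' S)) /= [X in _ = _ + X]big1 ?addr0 //.
    move=> S /andP[SPhi]; rewrite -leNgt => l'_le0.
    by have /eqP -> : l' S == 0; [rewrite eq_le l'_le0 l'_ge0 | rewrite mul0r].
  under eq_bigr => S _ do rewrite mulrBl -[_ * g S * _]mulrA.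
  by rewrite sumrB -mulr_sumr sum_l sum_g mulr0 subr0.
have /setP/(_ S1) : [set S in Phi | 0 < l' S] = Phi.
  by apply: minimal_balanced_sub_eq minPhi bal' _; rewrite setIdE subsetIl.
by rewrite inE S1Phi l'S1 ltxx.
Qed.

Lemma minimal_balanced_free (R : realType) n (Phi : {set {set 'I_n}})
    (g : {set 'I_n} -> R) :
  minimal_balanced R Phi ->
  (forall i, \sum_(S in Phi) g S * (i \in S)%:R = 0) ->
  forall S, S \in Phi -> g S = 0.
Proof.
move=> minPhi sum_g S SPhi; apply/eqP; rewrite eq_le.
rewrite (minimal_balanced_le0 minPhi sum_g SPhi) -oppr_le0.
apply: (minimal_balanced_le0 (g := fun S => - g S) minPhi) => // i.
by under eq_bigr do rewrite mulNr; rewrite sumrN sum_g oppr0.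
Qed.

(** Minimality makes the characteristic vectors of the members linearly independent in dimension
    [n]. *)
Lemma card_minimal_balanced_le (R : realType) n (Phi : {set {set 'I_n}}) :
  minimal_balanced R Phi -> (#|Phi| <= n)%N.
Proof.
move=> minPhi.
pose A : 'M[R]_(#|Phi|, n) := \matrix_(k, i) (i \in (enum_val k : {set _}))%:R.
suff /eqP <- : row_free A by exact: rank_leq_col.
apply: inj_row_free => v /rowP vA0.
(* For [S] in [Phi] this sum has a single term; it carries [v] over from indices to sets. *)
pose g S := \sum_(k < #|Phi| | enum_val k == S) v 0 k.
have g_val k : g (enum_val k) = v 0 k.
  by rewrite /g (eq_bigl (pred1 k)) ?big_pred1_eq // => j;
     rewrite (inj_eq enum_val_inj).
apply/rowP => k; rewrite [RHS]mxE -g_val.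
apply: (minimal_balanced_free minPhi) (enum_valP k) => i.
have := vA0 i; rewrite !mxE => vA0_i; rewrite -[RHS]vA0_i [LHS]big_enum_val.
by apply: eq_bigr => j _; rewrite g_val mxE.
Qed.

Lemma minimal_balanced_unique (R : realType) n (Phi : {set {set 'I_n}})
    (l f : {set 'I_n} -> R) (c : R) :
  minimal_balanced R Phi ->
  (forall i, \sum_(S in Phi) l S * (i \in S)%:R = 1) ->
  (forall i, \sum_(S in Phi) f S * (i \in S)%:R = c) ->
  forall S, S \in Phi -> f S = c * l S.
Proof.
move=> minPhi sum_l sum_f S SPhi; apply/eqP; rewrite -subr_eq0; apply/eqP.
apply: (minimal_balanced_free (g := fun S => f S - c * l S) minPhi) SPhi => i.
under eq_bigr => T _ do rewrite mulrBl -[c * _ * _]mulrA.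
by rewrite sumrB -mulr_sumr sum_f sum_l mulr1 subrr.
Qed.

(** * Complementation and the sets avoiding 0 *)

Lemma setC_neq m (S : {set 'I_m.+1}) : S != ~: S.
Proof. by apply/eqP => /setP/(_ ord0); rewrite inE; case: (_ \in _). Qed.

Lemma in_setC_imset (T : finType) (S : {set T}) (Phi : {set {set T}}) :
  (S \in (@setC T) @: Phi) = (~: S \in Phi).
Proof. by rewrite -{1}[S]setCK mem_imset //; apply: can_inj (@setCK T). Qed.

(** A complementary pair is already balanced, with unit weights. *)
Lemma minimal_balanced_setC2 (R : realType) m (Phi : {set {set 'I_m.+1}}) S :
  minimal_balanced R Phi -> S \in Phi -> ~: S \in Phi -> Phi = [set S; ~: S].
Proof.
move=> minPhi SPhi CSPhi; apply/esym/(minimal_balanced_sub_eq minPhi); last first.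
  by rewrite subUset !sub1set SPhi.
apply/balancedE; exists (fun=> 1) => // i.
rewrite big_setU1 ?inE ?setC_neq //= big_set1 !mul1r inE.
by case: (i \in S); rewrite /= ?addr0 ?add0r.
Qed.

Definition avoid0 m (S : {set 'I_m.+1}) := if ord0 \in S then ~: S else S.

Lemma avoid0_inj m (S T : {set 'I_m.+1}) :
  avoid0 S = avoid0 T -> T = S \/ T = ~: S.
Proof.
rewrite /avoid0; do 2![case: ifP => _] => eqST.
- by left; apply: setC_inj.
- by right.
- by right; rewrite eqST setCK.
- by left.
Qed.

Lemma avoid0_imset_inj (R : realType) m (Phi Phi' : {set {set 'I_m.+1}}) :
  minimal_balanced R Phi -> minimal_balanced R Phi' ->
  (@avoid0 m) @: Phi = (@avoid0 m) @: Phi' ->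
  Phi' = Phi \/ Phi' = (@setC _) @: Phi.
Proof.
move=> minPhi minPhi' eq_av.
have toP S : S \in Phi -> S \in Phi' \/ ~: S \in Phi'.
  move=> /(imset_f (@avoid0 m)); rewrite eq_av => /imsetP[T TPhi' /avoid0_inj].
  by case=> <-; [left | right].
have fromP S : S \in Phi' -> S \in Phi \/ ~: S \in Phi.
  move=> /(imset_f (@avoid0 m)); rewrite -eq_av => /imsetP[T TPhi /avoid0_inj].
  by case=> <-; [left | right].
(* A minimal balanced collection with a complementary pair is just that pair, and then contains any
   collection with the same image under [avoid0]. *)
have [[S SPhi CSPhi]|no_pair] := pselect (exists2 S, S \in Phi & ~: S \in Phi).
  left; apply: (minimal_balanced_sub_eq minPhi minPhi'.1).
  rewrite (minimal_balanced_setC2 minPhi SPhi CSPhi) in fromP *.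
  apply/subsetP => T /fromP [//|]; rewrite !inE.
  by case/orP => /eqP e; [rewrite -e setCK eqxx orbT | rewrite (setC_inj e) eqxx].
have [[S SPhi' CSPhi']|no_pair'] :=
    pselect (exists2 S, S \in Phi' & ~: S \in Phi').
  left; apply/esym/(minimal_balanced_sub_eq minPhi' minPhi.1).
  rewrite (minimal_balanced_setC2 minPhi' SPhi' CSPhi') in toP *.
  apply/subsetP => T /toP [//|]; rewrite !inE.
  by case/orP => /eqP e; [rewrite -e setCK eqxx orbT | rewrite (setC_inj e) eqxx].
have [/balancedE [l l_gt0 sum_l] _] := minPhi.
have [/balancedE [l' l'_gt0 sum_l'] _] := minPhi'.
(* The weights [l'] transported to [Phi]: the indicator of [~: S] is 1 minus that of [S], so
   complemented members change sign and [d] collects the constants. Uniqueness then forces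
   [f = (1 - d) * l] on [Phi]. *)
pose f S := if S \in Phi' then l' S else - l' (~: S).
pose d := \sum_(S in Phi | S \notin Phi') l' (~: S).
have sum_f i : \sum_(S in Phi) f S * (i \in S)%:R = 1 - d.
  rewrite -[X in _ = X - _](sum_l' i) (bigID (mem Phi')) /=.
  rewrite [X in _ = X - _](bigID (mem Phi)) /= -addrA; congr (_ + _).
    by apply: eq_big => [S|S /andP[_ SPhi']]; [rewrite andbC | rewrite /f SPhi'].
  rewrite [X in _ = X - _](reindex_inj (can_inj (@setCK _))) /=.
  rewrite [X in _ = X - _](eq_bigl (fun S => (S \in Phi) && (S \notin Phi')));
    last first.
    move=> S; apply/andP/andP => -[H1 H2]; split.
    - by have [|] := fromP _ H1; rewrite ?setCK // => /(negP H2).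
    - by apply/negP => SPhi'; apply: no_pair'; exists S.
    - by have [/(negP H2)|] := toP _ H1.
    - by apply/negP => CSPhi; apply: no_pair; exists S.
  rewrite /d -sumrB; apply: eq_bigr => S /andP[_ /negPf SPhi'].
  rewrite /f SPhi' inE; case: (i \in S); rewrite /= ?mulr1 ?mulr0 ?subrr //.
  by rewrite sub0r.
have f_l := minimal_balanced_unique minPhi sum_l sum_f.
(* On [Phi], [f] has the sign of [1 - d]; it is positive on members of [Phi'], negative on the
   others and never zero. So all members are shared, or all are complemented. *)
have [d_lt1|d_gt1|d1] := ltgtP d 1.
- left; apply/esym/(minimal_balanced_sub_eq minPhi' minPhi.1).
  apply/subsetP => S SPhi; apply: contraT => /negPf SPhi'.
  have := f_l S SPhi; rewrite /f SPhi' => /eqP.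
  have [//|/l'_gt0 l'S] := toP S SPhi; first by rewrite SPhi'.
  have : 0 < (1 - d) * l S by rewrite mulr_gt0 ?subr_gt0 ?l_gt0.
  by move=> /[swap] /eqP <-; rewrite oppr_gt0 ltNge ltW.
- right.
  have disj S : S \in Phi -> S \notin Phi'.
    move=> SPhi; apply/negP => SPhi'.
    have := f_l S SPhi; rewrite /f SPhi' => e.
    have : (1 - d) * l S < 0 by rewrite pmulr_llt0 ?subr_lt0 ?l_gt0.
    by rewrite -e ltNge ltW // l'_gt0.
  apply/setP => S; rewrite in_setC_imset.
  apply/idP/idP => [SPhi'|CSPhi].
    by have [/disj|//] := fromP _ SPhi'; rewrite SPhi'.
  by have [/(negP (disj _ CSPhi))//|] := toP _ CSPhi; rewrite setCK.
- exfalso; apply: (@not_balanced0 R m).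
  suff <- : Phi = set0 by case: minPhi.
  apply/setP => S; rewrite inE; apply/negP => SPhi.
  have := f_l S SPhi; rewrite d1 subrr mul0r /f.
  case: ifP => [/l'_gt0 l'S e|SPhi' /eqP]; first by rewrite e ltxx in l'S.
  have [|/l'_gt0 l'S] := toP S SPhi; first by rewrite SPhi'.
  by rewrite oppr_eq0 gt_eqF.
Qed.

(** * Counting small subfamilies and the upper bound *)

Lemma card_draws_le (T : finType) (A : {set T}) n :
  (#|[set B : {set T} | (B \subset A) && (0 < #|B| <= n)]|
     <= \sum_(1 <= k < n.+1) 'C(#|A|, k))%N.
Proof.
elim: n => [|n IHn].
  rewrite big_geq // leqn0 cards_eq0; apply/eqP/setP => B.
  by rewrite !inE leqn0; case: (#|B|) => [|?]; rewrite ?andbF.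
rewrite big_nat_recr //= -cards_draws; apply: leq_trans (leq_add IHn (leqnn _)).
apply: leq_trans (leq_card_setU _ _); apply/subset_leq_card/subsetP => B.
rewrite !inE => /and3P[-> -> /=].
by rewrite leq_eqVlt ltnS orbC; case/orP => ->; rewrite ?orbT.
Qed.

Lemma ffact_leq_expn M k : (M ^_ k <= M ^ k)%N.
Proof.
by elim: k => // k IHk; rewrite ffactnSr expnSr leq_mul ?leq_subr.
Qed.

(** Induction from [m] to [m + 1]: the old terms, multiplied by [m + 1], stay below
    [2 * (m + 1) * M ^ m], which is at most [M ^ (m + 1)]; the new binomial adds at most
    [M ^ (m + 1)]. *)
Lemma sum_bin_fact_lt M m : (0 < m)%N -> (m.*2 <= M)%N ->
  (m`! * \sum_(1 <= k < m.+1) 'C(M, k) < 2 * M ^ m)%N.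
Proof.
elim: m => // -[_ _|m IHm _ le_mM].
  rewrite big_nat1 (fact_prod 1) big_nat1 bin1 mul1n expn1 => M_gt0.
  by rewrite ltn_Pmull // ltnW.
rewrite big_nat_recr //= mulnDr [X in (_ + X < _)%N]mulnC bin_ffact.
have M_gt0 : (0 < M)%N by apply: leq_trans le_mM.
have /IHm : (m.+1.*2 <= M)%N by apply: leq_trans le_mM; rewrite leq_double.
move=> /(_ isT) lt_m.
apply: (@leq_trans (m.+2 * (2 * M ^ m.+1) + M ^ m.+2)%N).
  rewrite -addSn leq_add //.
    by rewrite [m.+2`!]factS -mulnA ltn_pmul2l.
  exact: ffact_leq_expn.
rewrite mulnA muln2 mul2n -[leqRHS]addnn leq_add2r [in leqRHS]expnS.
by rewrite leq_mul2r le_mM orbT.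
Qed.

Lemma num_minimal_balanced_le (R : realType) m :
  (num_minimal_balanced R m.+1 <=
     2 * \sum_(1 <= k < m.+2) 'C(2 ^ m, k))%N.
Proof.
pose h (Phi : {set {set 'I_m.+1}}) := (@avoid0 m) @: Phi.
pose reps : {set {set 'I_m.+1}} := powerset [set~ ord0].
have card_reps : #|reps| = (2 ^ m)%N by rewrite card_powerset cardsC1 card_ord.
rewrite -card_reps; apply: leq_trans (leq_mul (leqnn 2) (card_draws_le _ _)).
rewrite /num_minimal_balanced; set MB := [set Phi | _].
have MBP Phi : Phi \in MB -> minimal_balanced R Phi by rewrite inE => /asboolP.
rewrite -sum1_card (partition_big_imset h) /=.
apply: (@leq_trans (\sum_(Psi in h @: MB) 2)%N).
  apply: leq_sum => _ /imsetP[Phi0 /MBP minPhi0 ->].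
  rewrite sum1dep_card; apply: (@leq_trans #|[set Phi0; (@setC _) @: Phi0]|).
    apply/subset_leq_card/subsetP => Phi; rewrite inE => /andP[/MBP minPhi /eqP e].
    rewrite !inE; have [|->|->] := avoid0_imset_inj minPhi0 minPhi.
    - by rewrite -[LHS]e.
    - by rewrite eqxx.
    - by rewrite eqxx orbT.
  by rewrite cards2; case: (_ != _).
rewrite sum_nat_const mulnC leq_mul2l /=.
apply/subset_leq_card/subsetP => _ /imsetP[Phi /MBP minPhi ->].
rewrite inE; apply/and3P; split.
- apply/subsetP => _ /imsetP[S _ ->]; rewrite inE subsetC sub1set inE /avoid0.
  by case: ifP => [|->]; rewrite ?setCK // inE => ->.
- rewrite card_gt0 imset_eq0; apply/eqP => Phi0; apply: (@not_balanced0 R m).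
  by rewrite -Phi0; case: minPhi.
- exact: leq_trans (leq_imset_card _ _) (card_minimal_balanced_le minPhi).
Qed.

Lemma num_minimal_balanced_lt (R : realType) n : (2 <= n)%N ->
  (n`! * num_minimal_balanced R n < 4 * 2 ^ (n ^ 2 - n))%N.
Proof.
case: n => [//|m] m_gt0.
have -> : (m.+1 ^ 2 - m.+1 = m * m.+1)%N.
  by rewrite -mulnn -[X in (_ - X)%N]mul1n -mulnBl subn1.
rewrite expnM; apply: (@leq_ltn_trans
  (2 * (m.+1`! * \sum_(1 <= k < m.+2) 'C(2 ^ m, k)))%N).
  by rewrite mulnCA leq_mul2l num_minimal_balanced_le orbT.
rewrite -[4%N]/(2 * 2)%N -mulnA ltn_pmul2l //.
(* The condition [m.+1.*2 <= 2 ^ m] fails for [m = 1] and [m = 2], which are evaluated directly, and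
   holds from [m = 3] on. *)
case: m m_gt0 => [//|[|[|m _]]]; try by rewrite unlock.
apply: sum_bin_fact_lt => //; elim: m => // m IHm.
by rewrite expnS mul2n leq_double; apply: leq_trans IHm;
   rewrite -addnn -addn1 leq_add2l.
Qed.

(** * From a rigid relation to minimal balanced collections *)

(** Two equal members would give a solution with entries 1 and -1; a balanced proper subcollection,
    extended by zero, a nonzero solution with a zero entry. Neither is a multiple of the positive
    [x]. *)
Lemma imset_minimal_balanced (R : realType) n (I : finType)
    (t : I -> {set 'I_n.+1}) (x : I -> R) (c : R) :
  0 < c -> (forall j, 0 < x j) ->
  (forall i, \sum_j x j * (i \in t j)%:R = c) ->
  (forall y d, (forall i, \sum_j y j * (i \in t j)%:R = d) ->
     exists s, forall j, y j = s * x j) ->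
  injective t /\ minimal_balanced R (t @: I).
Proof.
move=> c_gt0 x_gt0 sum_x uniq_x.
have t_inj : injective t.
  move=> j j' eq_t; apply/eqP; apply: contraT => neq_j.
  pose y k : R := (k == j)%:R - (k == j')%:R.
  have [|s y_s] := uniq_x y 0.
    move=> i; under eq_bigr => k _ do rewrite mulrBl !mulr_natl !mulrb.
    by rewrite sumrB -!big_mkcond !big_pred1_eq eq_t subrr.
  have := y_s j; rewrite /y eqxx (negPf neq_j) subr0 => s_j.
  have := y_s j'; rewrite /y eqxx eq_sym (negPf neq_j) sub0r => s_j'.
  have s_gt0 : 0 < s by rewrite -(pmulr_lgt0 _ (x_gt0 j)) -s_j.
  by have := mulr_gt0 s_gt0 (x_gt0 j'); rewrite -s_j' oppr_gt0 ltr10.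
have sum_imset (f : {set 'I_n.+1} -> R) : \sum_(S in t @: I) f S = \sum_j f (t j).
  by rewrite big_imset //=; move=> ? ? _ _; apply: t_inj.
split=> //; split.
  apply/balancedE; exists (fun S => c^-1 * \sum_(j | t j == S) x j).
    move=> _ /imsetP[j _ ->]; rewrite mulr_gt0 ?invr_gt0 //.
    by rewrite (big_pred1 j) // => k; rewrite (inj_eq t_inj).
  move=> i; rewrite sum_imset; under eq_bigr => j _.
    rewrite (big_pred1 j) => [|k]; last by rewrite (inj_eq t_inj).
    rewrite -mulrA; over.
  by rewrite -mulr_sumr sum_x mulVf ?gt_eqF.
move=> Psi /properP[/subsetP sub [_ /imsetP[j0 _ ->] j0Psi]].
case/balancedE => l _ sum_l.
have [|s y_s] := uniq_x (fun j => if t j \in Psi then l (t j) else 0) 1.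
  move=> i; rewrite -[RHS](sum_l i) [RHS]big_mkcond /=.
  rewrite [RHS](bigID (mem (t @: I))) /= [X in _ = _ + X]big1 ?addr0; last first.
    by move=> S /negP SI; case: ifP => // /sub.
  rewrite sum_imset; apply: eq_bigr => j _.
  by case: ifP; rewrite ?mul0r.
have /esym/eqP := y_s j0; rewrite (negPf j0Psi) mulf_eq0.
rewrite (gt_eqF (x_gt0 j0)) orbF => /eqP s0.
have /eqP := sum_l ord0; rewrite big1 ?eqxx 1?eq_sym ?oner_eq0 //.
move=> S SPsi; have /imsetP[j _ eS] := sub _ SPsi.
by have := y_s j; rewrite -eS SPsi s0 mul0r => ->; rewrite mul0r.
Qed.

(** The two values of [b] give memberwise complementary families; for nonzero coefficients they
    belong to [x] and [- x]. *)
Definition flip_by (R : realType) n m (S : 'I_n -> {set 'I_m}) (x : 'I_n -> R)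
    (b : bool) (j : 'I_n) : {set 'I_m} :=
  if (0 < x j) (+) b then S j else ~: S j.

Lemma avoid0_flip_by (R : realType) n m (S : 'I_n -> {set 'I_m.+1})
    (x : 'I_n -> R) b j :
  ord0 \notin S j -> avoid0 (flip_by S x b j) = S j.
Proof.
move=> /negPf S0; rewrite /avoid0 /flip_by.
by case: (_ (+) _); rewrite ?inE S0 //= setCK.
Qed.

(** Complementing changes an indicator by a sign and a constant, so relations of constant value
    among the flipped sets come from relations of value 0 among the [S j], and [x] turns into its
    absolute values up to a global sign. *)
Lemma flip_by_minimal_balanced (R : realType) n m
    (S : 'I_n.+2 -> {set 'I_m.+1}) (x : 'I_n.+2 -> R) (b : bool) :
  (forall j, ord0 \notin S j) -> (forall j, x j != 0) ->
  (forall i, \sum_j x j * (i \in S j)%:R = 0) ->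
  (forall y : 'I_n.+2 -> R, (forall i, \sum_j y j * (i \in S j)%:R = 0) ->
     forall k, y k = 0 -> forall j, y j = 0) ->
  injective (flip_by S x b) /\ minimal_balanced R (flip_by S x b @: 'I_n.+2).
Proof.
move=> S0 x_neq0 sum_x rigid.
have uniq_x y : (forall i, \sum_j y j * (i \in S j)%:R = 0) ->
    forall j, y j = y ord0 / x ord0 * x j.
  move=> sum_y j; apply/eqP; rewrite -subr_eq0; apply/eqP.
  pose z j := y j - y ord0 / x ord0 * x j.
  apply: (rigid z _ ord0); last by rewrite /z divfK ?subrr.
  move=> i; under eq_bigr => k _ do rewrite mulrBl -[_ * x k * _]mulrA.
  by rewrite sumrB -mulr_sumr sum_y sum_x mulr0 subrr.
set t := flip_by S x b.
pose keep j := (0 < x j) (+) b.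
pose e j : R := (-1) ^+ ~~ keep j.
have in_t i j : (i \in t j)%:R = e j * (i \in S j)%:R + (~~ keep j)%:R :> R.
  rewrite /t /flip_by /e -/(keep j); case: (keep j) => /=.
    by rewrite mul1r addr0.
  by rewrite inE; case: (i \in S j); rewrite /= ?mulr1 ?mulr0 ?add0r // addNr.
have e_x j : e j * x j = (-1) ^+ b * `|x j|.
  rewrite /e /keep; case: (ltrgt0P (x j)) (x_neq0 j) => //= [xj _|xj _];
    by case: (b); rewrite /= ?mul1r ?mulN1r ?opprK.
have ee j : e j * e j = 1 by rewrite -expr2 sqrr_sign.
have sum_t (y : 'I_n.+2 -> R) i : \sum_j y j * (i \in t j)%:R =
    \sum_j (y j * e j) * (i \in S j)%:R + \sum_j y j * (~~ keep j)%:R.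
  rewrite -big_split /=; apply: eq_bigr => j _.
  by rewrite in_t mulrDr mulrA.
pose c := \sum_j `|x j| * (~~ keep j)%:R.
have sum_abs i : \sum_j `|x j| * (i \in t j)%:R = c.
  rewrite sum_t -[RHS]add0r; congr (_ + _).
  rewrite -[RHS](mulr0 ((-1) ^+ b)) -[X in _ = _ * X](sum_x i) mulr_sumr.
  apply: eq_bigr => j _.
  rewrite mulrA; congr (_ * _).
  have -> : `|x j| = (-1) ^+ b * (e j * x j) by rewrite e_x signrMK.
  by rewrite -mulrA [e j * _]mulrC -[x j * _ * _]mulrA [x j * _]mulrC ee mul1r.
(* Needed for [c > 0]. If all members were empty, so would be all [S j], and the unit vector at
   [ord0], which vanishes at [ord_max], would contradict rigidity. *)
have t_neq0 : exists j i, i \in t j.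
  have [//|no_t] := pselect (exists j i, i \in t j).
  have S_eq0 i j : i \in S j = false.
    apply/negP => iS; case: no_t; exists j.
    rewrite /t /flip_by; case: ifP => _; first by exists i.
    by exists ord0; rewrite inE.
  have /eqP : (ord0 == ord0 :> 'I_n.+2)%:R = 0 :> R.
    apply: (rigid (fun j => (j == ord0)%:R) _ ord_max) => // i.
    by apply: big1 => j _; rewrite S_eq0 mulr0.
  by rewrite eqxx oner_eq0.
apply: (@imset_minimal_balanced R m _ t (fun j => `|x j|) c) => //.
- have [j [i ij]] := t_neq0.
  rewrite -(sum_abs i) (bigD1 j) //= ij mulr1 ltr_pwDl ?normr_gt0 //.
  by apply: sumr_ge0 => k _; rewrite mulr_ge0 ?ler0n.
- by move=> j; rewrite normr_gt0.
- move=> y d sum_y.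
  (* No [S j] contains [ord0], so evaluation there isolates the constant part, which cancels at
     every [i]. *)
  have const i : \sum_j (y j * e j) * (i \in S j)%:R = 0.
    have := sum_y ord0; rewrite -(sum_y i) !sum_t => /addIr <-.
    by apply: big1 => j _; rewrite (negPf (S0 j)) mulr0.
  have y_s := uniq_x _ const.
  exists (y ord0 * e ord0 / x ord0 * (-1) ^+ b) => j.
  by rewrite -mulrA -e_x mulrCA -y_s mulrCA ee mulr1.
Qed.

(** * Set families from invertible matrices over F_2 *)

Lemma unitmx_intr_F2 (R : numFieldType) n (N : 'M[int]_n) :
  map_mx (intr : int -> 'F_2) N \in unitmx ->
  map_mx (intr : int -> R) N \in unitmx.
Proof.
rewrite !unitmxE !unitfE !det_map_mx intr_eq0.
by apply: contraNneq => ->; rewrite rmorph0.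
Qed.

Lemma natr_F2_neq0 (a : 'F_2) : (a != 0)%:R = a.
Proof. by case: a => [[|[|//]] i] /=; apply: val_inj. Qed.

Lemma oppr_F2 (a : 'F_2) : - a = a.
Proof. by case: a => [[|[|//]] i]; apply: val_inj. Qed.

(* The rows of A together with their sum, so that 1 + ... + 1 = 0 is the only
   relation between them when A is invertible. *)
Definition F2_rows m (A : 'M['F_2]_m) : 'M['F_2]_(1 + m, m) :=
  col_mx (const_mx 1 *m A) A.

(** Columns are shifted by one to leave element 0 outside all members, which makes them the
    representatives selected by [avoid0]. *)
Definition F2_family m (A : 'M['F_2]_m) (j : 'I_(1 + m)) : {set 'I_m.+1} :=
  [set i | if unlift ord0 i is Some i' then F2_rows A j i' != 0 else false].

Lemma ord0_F2_family m (A : 'M['F_2]_m) j : ord0 \notin F2_family A j.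
Proof. by rewrite inE unlift_none. Qed.

Lemma lift_F2_family m (A : 'M['F_2]_m) j i :
  (lift ord0 i \in F2_family A j) = (F2_rows A j i != 0).
Proof. by rewrite inE liftK. Qed.

Lemma F2_family_inj m : injective (@F2_family m).
Proof.
move=> A A' eq_fam; apply/matrixP => i j.
have /setP/(_ (lift ord0 j)) := congr1 (fun f => f (rshift 1 i)) eq_fam.
rewrite !lift_F2_family /F2_rows !col_mxEd => eqA.
by rewrite -[LHS]natr_F2_neq0 eqA natr_F2_neq0.
Qed.

(* Deleting any one row of F2_rows A leaves an invertible matrix over F_2, whose
   0/1 lift has an odd determinant and so is invertible over R as well. *)
Lemma F2_family_rigid (R : realType) m (A : 'M['F_2]_m) (y : 'I_(1 + m) -> R) k :
  A \in unitmx ->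
  (forall i, \sum_j y j * (i \in F2_family A j)%:R = 0) ->
  y k = 0 -> forall j, y j = 0.
Proof.
move=> A_unit sum_y yk0.
(* Instead of deleting row [k], the column [delta_mx k 0] is prepended: the matrix is square and the
   extra equation is [y k = 0]. *)
pose N : 'M[int]_(1 + m) :=
  row_mx (delta_mx k 0) (\matrix_(j, i) (F2_rows A j i != 0)%:R : 'M_(1 + m, m)).
have N_unit : map_mx (intr : int -> 'F_2) N \in unitmx.
  have -> : map_mx (intr : int -> 'F_2) N = row_mx (delta_mx k 0) (F2_rows A).
    rewrite map_row_mx map_delta_mx; congr row_mx.
    by apply/matrixP => j i; rewrite !mxE mulrz_nat natr_F2_neq0.
  rewrite -row_free_unit; apply: inj_row_free => v.
  rewrite mul_mx_row -[X in _ = X -> _]row_mx0 => /eq_row_mx [vk].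
  rewrite -[v]hsubmxK /F2_rows mul_row_col mulmxA -mulmxDl => vA.
  have : lsubmx v *m const_mx 1 + rsubmx v = 0.
    by rewrite -[LHS](mulmxK A_unit) vA mul0mx.
  move=> rel.
  have v_const j : v 0 j = v 0 (lshift m 0).
    case: (split_ordP j) => j' ->; first by rewrite [j']ord1.
    have /rowP/(_ j') := rel; rewrite !mxE big_ord1 !mxE mulr1 => /eqP.
    by rewrite addr_eq0 oppr_F2 => /eqP.
  rewrite hsubmxK; apply/rowP => j; rewrite v_const -(v_const k) [RHS]mxE.
  have /matrixP/(_ 0 0) := vk; rewrite !mxE (bigD1 k) //= !mxE !eqxx mulr1.
  by rewrite big1 ?addr0 // => l /negPf l_k; rewrite !mxE l_k mulr0.
have: (\row_j y j) *m map_mx (intr : int -> R) N = 0.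
  rewrite map_row_mx map_delta_mx mul_mx_row -[RHS]row_mx0; congr row_mx.
    apply/rowP => i; rewrite !mxE (bigD1 k) //= !mxE yk0 mul0r add0r.
    by rewrite big1 // => l /negPf l_k; rewrite !mxE l_k mulr0.
  apply/rowP => i; rewrite !mxE; apply: etrans (sum_y (lift ord0 i)).
  by apply: eq_bigr => j _; rewrite lift_F2_family !mxE mulrz_nat.
move/(congr1 (mulmx^~ (invmx (map_mx (intr : int -> R) N)))).
rewrite mul0mx mulmxK ?unitmx_intr_F2 // => /rowP y0 j.
by have := y0 j; rewrite !mxE.
Qed.

(** There are [m + 1] vectors in dimension [m], hence a nontrivial relation; by rigidity none of its
    coefficients vanishes. *)
Lemma F2_family_relation (R : realType) m (A : 'M['F_2]_m) :
  A \in unitmx ->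
  exists x : 'I_(1 + m) -> R, (forall j, x j != 0) /\
    forall i, \sum_j x j * (i \in F2_family A j)%:R = 0.
Proof.
move=> A_unit.
pose L : 'M[R]_(1 + m, m) := \matrix_(j, i) (F2_rows A j i != 0)%:R.
have : ~~ row_free L.
  by rewrite -row_leq_rank -ltnNge ltnS rank_leq_col.
rewrite -kermx_eq0 => /rowV0Pn [x /sub_kermxP xL x_neq0].
have sum_x i : \sum_j x 0 j * (i \in F2_family A j)%:R = 0.
  case: (unliftP ord0 i) => [i'|] ->.
    have /rowP/(_ i') := xL; rewrite !mxE => sum_x; apply: etrans sum_x.
    by apply: eq_bigr => j _; rewrite lift_F2_family [L _ _]mxE.
  by apply: big1 => j _; rewrite (negPf (ord0_F2_family _ _)) mulr0.
exists (x 0); split=> // j; apply: contraNneq x_neq0 => xj0.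
by apply/eqP/rowP => i; rewrite [RHS]mxE (F2_family_rigid A_unit sum_x xj0).
Qed.

(** * Counting ordered collections and the lower bound *)

(** A collection has at most [n] members, so it has [n]! orderings by 'I_n if it has exactly [n] and
    none otherwise. *)
Lemma card_ordered_minimal_balanced_le (R : realType) n :
  (#|[set t : {ffun 'I_n -> {set 'I_n}} |
       injectiveb t && `[< minimal_balanced R (t @: 'I_n) >]]|
     <= n`! * num_minimal_balanced R n)%N.
Proof.
set T := [set t | _]; set im := fun t : {ffun 'I_n -> {set 'I_n}} => t @: 'I_n.
rewrite -sum1_card.
rewrite (partition_big im (mem [set Phi | `[< minimal_balanced R Phi >]]));
  last first.
  by move=> t; rewrite !inE => /andP[].
rewrite mulnC -sum_nat_const; apply: leq_sum => Phi PhiMB.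
have minPhi : minimal_balanced R Phi by move: PhiMB; rewrite /= inE => /asboolP.
rewrite sum1dep_card; apply: (@leq_trans (#|Phi| ^_ n)).
  rewrite -[X in (_ <= _ ^_ X)%N]card_ord -(card_inj_ffuns_on 'I_n (mem Phi)).
  apply/subset_leq_card/subsetP => t; rewrite !inE => /andP[/andP[-> _] /eqP <-].
  by rewrite andbT; apply/ffun_onP => j; apply: imset_f.
have := card_minimal_balanced_le minPhi; rewrite leq_eqVlt => /orP[/eqP ->|lt_n].
  by rewrite ffactnn.
by rewrite ffact_small.
Qed.

Lemma card_GL_F2_ge m : (0 < m)%N -> (2 ^ (m ^ 2) <= 4 * #|'GL_m['F_2]%g|)%N.
Proof.
move=> m_gt0; rewrite card_GL // card_Fp //.
(* the product of 1 - 2^-i for 1 <= i <= k is at least 1/4 + 1/2^(k+1),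
   a strengthening of the bound 1/4 that is stable under induction *)
have prod_ge k : (2 ^ 'C(k.+2, 2) * (2 ^ k.+1 + 2) <=
    2 ^ k.+1 * (4 * \prod_(1 <= i < k.+2) (2 ^ i - 1)))%N.
  elim: k => [|k IHk]; first by rewrite big_nat1.
  rewrite big_nat_recr //= binS bin1 expnD [(2 ^ k.+2)%N]expnS.
  have q_ge2 : (2 <= 2 ^ k.+1)%N by rewrite -[leqLHS]expn1 leq_exp2l.
  move: IHk q_ge2; set P := (\prod_(_ <= _ < _) _)%N.
  move: P (2 ^ k.+1)%N (2 ^ _)%N => P q c; nia.
case: m m_gt0 => // m _; rewrite mulnCA.
(* This splits off the power of 2 in the group order, leaving the product of the [2 ^ i - 1]. *)
have -> : (m.+1 ^ 2 = 'C(m.+1, 2) + 'C(m.+2, 2))%N.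
  rewrite (binS m.+1) bin1 addnA addnn -muln2 -[2%N]/(2`!) bin_ffact.
  by rewrite ffactnS ffactn1 -mulnSr.
rewrite expnD leq_mul2l -(leq_pmul2l (expn_gt0 2 m.+1)).
apply/orP; right; apply: leq_trans (prod_ge m).
by rewrite mulnC leq_mul2l leq_addr orbT.
Qed.

Lemma num_minimal_balanced_ge (R : realType) m :
  (2 * #|'GL_m.+1['F_2]%g| <= m.+2`! * num_minimal_balanced R m.+2)%N.
Proof.
apply: leq_trans (card_ordered_minimal_balanced_le R m.+2).
have /choice [x x_rel] : forall g : {'GL_m.+1['F_2]}, exists x : 'I_m.+2 -> R,
    (forall j, x j != 0) /\
    forall i, \sum_j x j * (i \in F2_family (GLval g) j)%:R = 0.
  by move=> g; apply: F2_family_relation; exact: (GL_unitmx g).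
pose t (p : {'GL_m.+1['F_2]} * bool) : {ffun 'I_m.+2 -> {set 'I_m.+2}} :=
  [ffun j => flip_by (F2_family (GLval p.1)) (x p.1) p.2 j].
(* [avoid0] recovers the family, hence the matrix; [b] is then read off because a set differs from
   its complement. *)
have t_inj : injective t.
  move=> [g b] [g' b'] /ffunP eq_t.
  have eq_g : g = g'.
    apply/val_inj/F2_family_inj/funext => j.
    have := congr1 (@avoid0 _) (eq_t j).
    by rewrite !ffunE !avoid0_flip_by ?ord0_F2_family.
  subst g'; congr pair; have := eq_t ord0; rewrite !ffunE /flip_by /=.
  case: (0 < x g ord0); case: b {eq_t}; case: b' => //= /eqP;
    by rewrite ?[~: _ == _]eq_sym (negPf (setC_neq _)).
have -> : (2 * #|'GL_m.+1['F_2]%g| = #|{: {'GL_m.+1['F_2]} * bool}|)%N.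
  by rewrite card_prod card_bool mulnC cardsT.
rewrite -cardsT -(card_imset _ t_inj); apply/subset_leq_card/subsetP.
move=> _ /imsetP[[g b] _ ->]; rewrite inE.
have [x_neq0 sum_x] := x_rel g.
have [inj_flip min_flip] := flip_by_minimal_balanced b
  (ord0_F2_family _) x_neq0 sum_x
  (fun y sum_y k => F2_family_rigid (k := k) (GL_unitmx g) sum_y).
apply/andP; split.
  by apply/injectiveP => j j'; rewrite !ffunE => /inj_flip.
apply/asboolP.
rewrite (_ : _ @: _ = flip_by (F2_family (GLval g)) (x g) b @: 'I_m.+2) //.
by apply: eq_imset => j; rewrite ffunE.
Qed.

(** * The case n = 1 and the final estimates *)

Lemma num_minimal_balanced1 (R : realType) : num_minimal_balanced R 1 = 1%N.
Proof.
have setT_eq (S : {set 'I_1}) : S != set0 -> S = setT.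
  by case/set0Pn => i iS; apply/setP => j; rewrite [j]ord1 -[0](ord1 i) iS inE.
have bal_T : balanced R [set [set: 'I_1]].
  by apply/balancedE; exists (fun=> 1) => // i; rewrite big_set1 inE mulr1.
have T_in Phi : balanced R Phi -> [set: 'I_1] \in Phi.
  case/balancedE => l _ /(_ ord0) sum_l; apply: contraT => noT.
  have /eqP := sum_l; rewrite big1 ?[0 == _]eq_sym ?oner_eq0 // => S SPhi.
  have [->|/setT_eq eS] := eqVneq S set0; first by rewrite inE mulr0.
  by rewrite -eS SPhi in noT.
rewrite /num_minimal_balanced (_ : [set Phi | _] = [set [set setT]]) ?cards1 //.
apply/setP => Phi; rewrite !inE; apply/asboolP/eqP => [minPhi|->].
  apply/esym/(minimal_balanced_sub_eq minPhi bal_T).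
  by rewrite sub1set T_in //; case: minPhi.
split=> // Psi /properP[_ [S]]; rewrite inE => /eqP -> TPsi /T_in.
by rewrite (negPf TPsi).
Qed.

Theorem propositionB1 (R : realType) :
  (forall n : nat, (2 <= n)%N ->
     2 ^+ (n ^ 2 - n - 1)%N / (n`!%:R * (2 ^+ n - n%:R))
       <= (num_minimal_balanced R n)%:R :> R
     /\ (num_minimal_balanced R n)%:R < 4 / n`!%:R * 2 ^+ (n ^ 2 - n)%N :> R)
  /\ num_minimal_balanced R 1 = 1%N.
Proof.
split=> [n n_ge2|]; last exact: num_minimal_balanced1.
have fact_gt0n : 0 < n`!%:R :> R by rewrite ltr0n fact_gt0.
split; last first.
  rewrite mulrAC ltr_pdivlMr // -natrX -!natrM ltr_nat mulnC.
  exact: num_minimal_balanced_lt.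
case: n n_ge2 fact_gt0n => [|[|m]] // _ fact_gt0n.
(* With n = [m.+2], this yields 2^n - n >= 2^(n-1), which replaces the denominator by a power of
   2. *)
have le_pow : (m.+2 + 2 ^ m.+1 <= 2 ^ m.+2)%N.
  by rewrite [leqRHS]expnS mul2n -addnn leq_add2r ltn_expl.
have le_B : (2 ^ (m.+1 ^ 2) <= 2 * (m.+2`! * num_minimal_balanced R m.+2))%N.
  apply: leq_trans (card_GL_F2_ge (ltn0Sn m)) _.
  by rewrite -[4%N]/(2 * 2)%N -mulnA leq_mul2l num_minimal_balanced_ge.
have le_sub : 2 ^+ m.+1 <= 2 ^+ m.+2 - m.+2%:R :> R.
  by rewrite lerBrDl -!natrX -natrD ler_nat.
have sub_gt0 : 0 < 2 ^+ m.+2 - m.+2%:R :> R.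
  by apply: lt_le_trans le_sub; rewrite exprn_gt0.
rewrite ler_pdivrMr ?mulr_gt0 // mulrA.
apply: (@le_trans _ _ ((num_minimal_balanced R m.+2)%:R * m.+2`!%:R * 2 ^+ m.+1)).
  rewrite -natrX -!natrM -natrX -natrM ler_nat.
  (* After doubling, the exponents agree: (n-1)^2 + (n-1) = n^2 - n. *)
  rewrite -(leq_pmul2l (isT : 0 < 2)%N) mulnA [(_ * m.+2`!)%N]mulnC.
  apply: leq_trans (leq_mul le_B (leqnn _)).
  by rewrite -expnS -expnD leq_exp2l //; lia.
by rewrite ler_wpM2l // mulr_ge0.
Qed.
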